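(* Let $f\colon\mathbb{R}^d\to\mathbb{R}$ be a CPWL function and $\mathcal{C}$ a polyhedral complex in $\mathbb{R}^d$. Every minimal decomposition $(g,h)\in\mathcal{D}_{\mathcal{C}}(f)$ is a vertex of the polyhedron $\mathcal{D}_{\mathcal{C}}(f)$.
   Context: A polyhedral complex $\mathcal{C}$ in $\mathbb{R}^d$ is a finite collection of polyhedra containing $\emptyset$, closed under taking faces, such that any two members intersect in a common face; $\mathcal{C}^d$ denotes the set of $d$-dimensional members. All polyhedral complexes are assumed pure of dimension $d$ and complete (the union of the members is $\mathbb{R}^d$). A function $f\colon\mathbb{R}^d\to\mathbb{R}$ is CPWL (continuous and piecewise linear) if there is such a complex $\mathcal{C}$ with $f$ affine on every member of $\mathcal{C}$; then $f$ and $\mathcal{C}$ are called compatible. The number of pieces of a CPWL function is the smallest possible value of $\#\mathcal{C}^d$ over all compatible complexes $\mathcal{C}$ (for a convex function this equals the number of distinct affine functions occurring on its full-dimensional regions); it is unchanged by adding an affine function. $\mathcal{V}_{\mathcal{C}}$ is the (finite-dimensional) vector space of CPWL functions compatible with $\mathcal{C}$, $\overline{\mathcal{V}}_{\mathcal{C}}=\mathcal{V}_{\mathcal{C}}/\mathrm{Aff}(\mathbb{R}^d)$ its quotient by affine functions, and $\overline{\mathcal{V}}_{\mathcal{C}}^{+}\subseteq\overline{\mathcal{V}}_{\mathcal{C}}$ is the polyhedral cone of classes of convex functions. The decomposition polyhedron is $\mathcal{D}_{\mathcal{C}}(f)=\{(g,h)\mid g,h\in\overline{\mathcal{V}}_{\mathcal{C}}^{+},\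 f=g-h\}$ (equality modulo affine functions), a polyhedron in $\overline{\mathcal{V}}_{\mathcal{C}}\times\overline{\mathcal{V}}_{\mathcal{C}}$. A decomposition $(g,h)\in\mathcal{D}_{\mathcal{C}}(f)$ is called minimal if there is no other $(g',h')\in\mathcal{D}_{\mathcal{C}}(f)$ such that $g'$ has at most as many pieces as $g$, $h'$ has at most as many pieces as $h$, and one of the two has strictly fewer pieces. *)

(* Defs.v *)
From HB Require Import structures.
From mathcomp Require Import all_boot all_order all_algebra generic_quotient.
From mathcomp Require Import ring_quotient.
From mathcomp Require Import boolp classical_sets functions cardinality reals.
From mathcomp Require Import convex.

Set Implicit Arguments.
Unset Strict Implicit.
Unset Printing Implicit Defensive.

Import Order.TTheory GRing.Theory Num.Theory.
Local Open Scope classical_set_scope.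
Local Open Scope card_scope.
Local Open Scope quotient_scope.
Local Open Scope ring_scope.

Section Polyhedra.
Context {R : realType}.

Definition polyhedron (E : lmodType R) (P : set E) : Prop :=
  exists (n : nat) (phi : 'I_n -> {linear E -> R^o}) (b : 'I_n -> R),
    P = [set x | forall i, phi i x <= b i].

(* Taking (phi, c) = (0, 0), resp. (0, 1), shows that P and the empty set are
   faces of P. *)
Definition face (E : lmodType R) (P F : set E) : Prop :=
  exists (phi : {linear E -> R^o}) (c : R),
    (forall x, P x -> phi x <= c) /\ F = P `&` [set x | phi x = c].

(* A zero-dimensional face, identified with its unique point. *)
Definition vertex (E : lmodType R) (P : set E) (x : E) : Prop :=
  face P [set x].

Definition affine_hull (E : lmodType R) (A : set E) : set E :=
  [set x | exists (n : nat) (p : 'I_n -> E) (c : 'I_n -> R),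
     [/\ forall i, A (p i), \sum_i c i = 1 & x = \sum_i c i *: p i]].

(* The affine hull of A is a translate of a k-dimensional linear subspace; the
   empty set has no dimension. *)
Definition has_dim (E : vectType R) (A : set E) (k : nat) : Prop :=
  exists (x0 : E) (U : {vspace E}),
    \dim U = k /\ affine_hull A = [set x | x - x0 \in U].

Definition affine_on (E : lmodType R) (P : set E) (f : E -> R^o) : Prop :=
  exists (phi : {linear E -> R^o}) (c : R), forall x, P x -> f x = phi x + c.

End Polyhedra.

Section Complexes.
Context {R : realType} {d : nat}.
Local Notation point := 'rV[R]_d.
Implicit Types (C : set (set point)) (f : point -> R^o).

(* The complex is moreover required to be pure of dimension d and complete. *)
Record polyhedral_complex C : Prop := PolyhedralComplex {
  complex_finite : finite_set C ;
  complex_polyhedron : forall P, C P -> polyhedron P ;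
  complex_empty : C set0 ;
  complex_face : forall P F, C P -> face P F -> C F ;
  complex_meet : forall P Q, C P -> C Q ->
    face P (P `&` Q) /\ face Q (P `&` Q) ;
  complex_pure : forall P, C P ->
    (forall Q, C Q -> P `<=` Q -> Q = P) -> has_dim P d ;
  complex_complete : \bigcup_(P in C) P = setT
}.

Definition full_cells C : set (set point) := [set P | C P /\ has_dim P d].

Definition compatible C f : Prop := forall P, C P -> affine_on P f.

Definition cpwl f : Prop :=
  exists C, polyhedral_complex C /\ compatible C f.

Definition realizes_pieces f (n : nat) : Prop :=
  exists C, [/\ polyhedral_complex C, compatible C f & full_cells C #= `I_n].

(* Only meaningful for CPWL functions, see npiecesP. *)
Definition npieces f : nat :=
  xget 0%N [set n | realizes_pieces f n /\
                    forall m, realizes_pieces f m -> (n <= m)%N].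

Lemma npiecesP f : cpwl f ->
  realizes_pieces f (npieces f) /\
  forall m, realizes_pieces f m -> (npieces f <= m)%N.
Proof.
move=> [C [hC hf]].
have [n hn] : exists n, full_cells C #= `I_n.
  apply/finite_setP; apply: sub_finite_set (complex_finite hC).
  by move=> P [].
have ex : exists n, `[< realizes_pieces f n >].
  by exists n; apply/asboolP; exists C.
pose m := ex_minn ex.
apply: (@xgetPex _ 0%N [set n | realizes_pieces f n /\
                    forall m, realizes_pieces f m -> (n <= m)%N]).
exists m; rewrite /m; case: ex_minnP => k /asboolP hk hmin; split=> // l hl.
by apply: hmin; apply/asboolP.
Qed.

Lemma affine_on0 (P : set point) : affine_on P (0 : point -> R^o).
Proof. by exists \0, 0 => x _; rewrite addr0. Qed.

Lemma affine_onD (P : set point) f g :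
  affine_on P f -> affine_on P g -> affine_on P (f + g).
Proof.
move=> [u [b hu]] [v [c hv]]; exists (u \+ v), (b + c) => x Px.
by rewrite [LHS]/GRing.add /= hu // hv // addrACA.
Qed.

Lemma affine_onZ (P : set point) (a : R) f :
  affine_on P f -> affine_on P (a *: f).
Proof.
move=> [u [b hu]]; exists (a \*: u), (a * b) => x Px.
by rewrite /= [LHS]/(a * f x) hu //; exact: mulrDr.
Qed.

Definition compatible_pred C : {pred point -> R^o} :=
  fun f => `[< compatible C f >].

Lemma compatible_submod C : submod_closed (compatible_pred C).
Proof.
split; first by apply/asboolP => P _; exact: affine_on0.
move=> a f g /asboolP hf /asboolP hg; apply/asboolP => P CP.
by apply: affine_onD (hg _ CP); apply: affine_onZ (hf _ CP).
Qed.

HB.instance Definition _ C :=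
  GRing.isSubmodClosed.Build R (point -> R^o) (compatible_pred C)
    (compatible_submod C).

Record VC C := MkVC {
  VC_fun :> point -> R^o ;
  VC_compatible : VC_fun \in compatible_pred C
}.

HB.instance Definition _ C := [isSub for @VC_fun C].
HB.instance Definition _ C := [Choice of VC C by <:].
HB.instance Definition _ C := [SubChoice_isSubLmodule of VC C by <:].

Definition Aff C : {pred VC C} :=
  fun g => `[< affine_on setT (g : point -> R^o) >].

Lemma Aff_submod C : submod_closed (@Aff C).
Proof.
split; first by apply/asboolP; exact: affine_on0.
move=> a f g /asboolP hf /asboolP hg; apply/asboolP.
by apply: affine_onD hg; apply: affine_onZ hf.
Qed.

HB.instance Definition _ C :=
  GRing.isSubmodClosed.Build R (VC C) (@Aff C) (@Aff_submod C).

Definition VCbar C : Type := Quotient.quot (@Aff C).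

HB.instance Definition _ C := Choice.on (VCbar C).
HB.instance Definition _ C := GRing.Zmodule.on (VCbar C).
HB.instance Definition _ C := EqQuotient.on (VCbar C).

Definition VCbar_class C : VC C -> VCbar C := \pi_(VCbar C).

Definition VCbar_scale C (a : R) (u : VCbar C) : VCbar C :=
  VCbar_class (a *: repr u).

Lemma VCbar_classE C (g h : VC C) :
  (VCbar_class g == VCbar_class h) = (g - h \in @Aff C).
Proof. by rewrite /VCbar_class Quotient.idealrBE. Qed.

Lemma VCbar_classD C (g h : VC C) :
  VCbar_class (g + h) = VCbar_class g + VCbar_class h.
Proof. exact: (Quotient.pi_add (@Aff C)). Qed.

Lemma VCbar_classN C (g : VC C) : VCbar_class (- g) = - VCbar_class g.
Proof. exact: (Quotient.pi_opp (@Aff C)). Qed.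

Lemma VCbar_reprK C (u : VCbar C) : VCbar_class (repr u) = u.
Proof. exact: reprK. Qed.

Lemma VCbar_classZ C (a : R) (g : VC C) :
  VCbar_class (a *: g) = VCbar_scale a (VCbar_class g).
Proof.
apply/eqP; rewrite VCbar_classE -scalerBr rpredZ // -VCbar_classE.
by rewrite VCbar_reprK.
Qed.

Lemma VCbar_scaleA C (a b : R) (u : VCbar C) :
  VCbar_scale a (VCbar_scale b u) = VCbar_scale (a * b) u.
Proof. by rewrite -[u]VCbar_reprK -!VCbar_classZ scalerA. Qed.

Lemma VCbar_scale1 C : left_id 1 (@VCbar_scale C).
Proof. by move=> u; rewrite -[u]VCbar_reprK -VCbar_classZ scale1r. Qed.

Lemma VCbar_scaleDr C : right_distributive (@VCbar_scale C) +%R.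
Proof.
move=> a u v; rewrite -[u]VCbar_reprK -[v]VCbar_reprK.
by rewrite -VCbar_classD -!VCbar_classZ -VCbar_classD scalerDr.
Qed.

Lemma VCbar_scaleDl C (u : VCbar C) :
  {morph (@VCbar_scale C)^~ u : a b / a + b}.
Proof.
move=> a b; rewrite -[u]VCbar_reprK -!VCbar_classZ -VCbar_classD.
by rewrite scalerDl.
Qed.

HB.instance Definition _ C :=
  GRing.Zmodule_isLmodule.Build R (VCbar C)
    (@VCbar_scaleA C) (@VCbar_scale1 C) (@VCbar_scaleDr C) (@VCbar_scaleDl C).

(* The cone of classes of convex functions; as convexity is invariant under
   adding an affine function, one convex representative suffices. *)
Definition VCplus C : set (VCbar C) :=
  [set u | exists g : VC C, convex_function setT g /\ u = VCbar_class g].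

(* Well defined by npieces_class. *)
Definition class_npieces C (u : VCbar C) : nat := npieces (repr u).

Lemma npieces_class C (g : VC C) : class_npieces (VCbar_class g) = npieces g.
Proof.
have aff : (repr (VCbar_class g) - g) \in @Aff C.
  by rewrite -VCbar_classE VCbar_reprK.
suff eq_comp D : compatible D (repr (VCbar_class g)) <-> compatible D g.
  rewrite /class_npieces /npieces; congr (xget _ _).
  suff -> : realizes_pieces (repr (VCbar_class g)) = realizes_pieces g by [].
  apply/funext => n; apply/propext.
  by split=> -[D [hD /eq_comp gD nD]]; exists D; split.
set h := repr _ in aff *.
pose h0 : point -> R^o := h; pose g0 : point -> R^o := g.
have sub P : affine_on P (h0 - g0).
  by move/asboolP: aff => [u [c huc]]; exists u, c => x _; exact: huc.
split=> hD P DP.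
  rewrite (_ : VC_fun g = - 1 *: (h0 - g0) + h0).
    by apply: affine_onD (hD P DP); apply: affine_onZ.
  by rewrite scaleN1r opprB (subrK h0 g0).
rewrite (_ : VC_fun h = (h0 - g0) + g0); last by rewrite (subrK g0 h0).
by apply: affine_onD (hD P DP).
Qed.

(* The condition f = g - h modulo affine functions forces f itself to be
   compatible with C, so that f has a class in VCbar C. *)
Definition decomposition_polyhedron C f : set (VCbar C * VCbar C) :=
  [set gh | [/\ VCplus gh.1, VCplus gh.2 &
     exists2 F : VC C, VC_fun F = f & VCbar_class F = gh.1 - gh.2]].

Definition minimal_decomposition C f (gh : VCbar C * VCbar C) : Prop :=
  decomposition_polyhedron f gh /\
  ~ exists gh' : VCbar C * VCbar C,
      [/\ gh' <> gh, decomposition_polyhedron f gh',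
          (class_npieces gh'.1 <= class_npieces gh.1)%N,
          (class_npieces gh'.2 <= class_npieces gh.2)%N &
          (class_npieces gh'.1 < class_npieces gh.1)%N \/
          (class_npieces gh'.2 < class_npieces gh.2)%N].

End Complexes.

Arguments VCplus {R d} C.
Arguments decomposition_polyhedron {R d} C f.
Arguments minimal_decomposition {R d} C f gh.

(* Main.v *)
Require Import Defs.
From HB Require Import structures.
From mathcomp Require Import all_boot all_order all_algebra ring lra.
From mathcomp Require Import boolp classical_sets functions cardinality reals.
From mathcomp Require Import interval_inference convex topology normedtype.

(** Vertices are exposed points here, so a linear functional that peaks on the
decomposition polyhedron exactly at the minimal decomposition (g, h) has to be
produced. A compatible function is given by one affine function per
full-dimensional cell; say that it merges two cells if these coincide. For
cells P_i, P_j with interior points y_i, y_j, the affine function on P_i of a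
convex function lies below that function, and it meets it at y_j only if it is
the affine function on P_j as well. This meeting is detected by the convexity
gap of the function on a segment from y_i to y_j, which is a linear
functional, nonnegative on convex functions. Let phi be minus the sum of the
gaps over the pairs of cells merged by g, plus the same for h
([tangency_functional]). It vanishes at (g, h), and a decomposition (g', h')
on which it vanishes merges all the cells that g, respectively h, merges.

It remains to see that (g', h') = (g, h) modulo affine functions. Put w = g' -
g, which is also h' - h up to an affine function. The key fact
([convex_perturb]) is that if w merges all the cells merged by a convex
function g, then g + s w is convex for all small s of either sign. Consider
the set of all s for which g + s w and h + s w are both convex. If it were
bounded, say above, it would have a largest element s. Along the line the
function w stays affine on every cell of every complex compatible with g
([perturbable_compatible]), so g + s w and h + s w have at most as many pieces
as g and h; by minimality they have exactly as many. Then g + s w has distinct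
affine functions on distinct cells of an optimal complex for g, because
otherwise the regions where the affine functions of g + s w attain the maximum
would form a complex with fewer cells ([fewer_pieces]). So the key fact
applies to g + s w, vacuously, and in the same way to h + s w, and the line
can be continued beyond s ([convex_along_unbounded]). Hence the set is
unbounded in both directions, which makes w both convex and concave, that is,
affine.

For the key fact, convexity of g + s w means that each of its affine functions
lies below it. Walk along a segment from the cell of that affine function to
the target point. At each crossing, from P_k to P_j, the differences p and q
of the two affine functions of g and of w both vanish, and p is nonnegative
beyond the crossing. If q is a multiple of p, then p + s q is nonnegative too
when s is small, uniformly over the finitely many pairs of cells. Otherwise
the common zeros of p and q have codimension at least 2, and a generic segment
misses it. General position thus replaces any discussion of facets and
adjacency. *)

Set Implicit Arguments.
Unset Strict Implicit.
Unset Printing Implicit Defensive.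

Import Order.TTheory GRing.Theory Num.Theory numFieldNormedType.Exports.
Local Open Scope classical_set_scope.
Local Open Scope card_scope.
Local Open Scope ring_scope.

(** * Signs of affine functions of a small positive parameter *)
Section Germs.
Context {R : realType}.
Implicit Types (a b : R).

Lemma near0_lt0 a b : a < 0 -> \forall t \near 0^'+, a + t * b < 0.
Proof.
move=> a0; near=> t.
have t0 : 0 < t by [].
have tb : t < - a / (1 + `|b|).
  near: t; apply: nbhs_right_lt.
  by rewrite divr_gt0 ?oppr_gt0// ltr_wpDr.
have : t * (1 + `|b|) < - a by rewrite -ltr_pdivlMr// ltr_wpDr.
have := ler_norm b; nra.
Unshelve. all: by end_near. Qed.

(** An affine function of one variable keeps a constant weak sign to the right
of 0; this dichotomy stands in for topological arguments about polyhedra. *)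
Lemma near0_sign a b :
  (a <= 0 /\ \forall t \near 0^'+, a + t * b <= 0) \/
  \forall t \near 0^'+, 0 < a + t * b.
Proof.
have [a0|a0|->] := ltgtP a 0.
- left; split=> //.
  by apply: filterS (near0_lt0 b a0) => t /= /ltW.
- right; have Na : - a < 0 by rewrite oppr_lt0.
  by apply: filterS (near0_lt0 (- b) Na) => t /=; lra.
- have [b0|b0] := leP b 0; [left; split=> //|right]; near=> t.
    by have t0 : 0 < t by []; nra.
  by have t0 : 0 < t by []; nra.
Unshelve. all: by end_near. Qed.

Lemma near0_le0 a b : (\forall t \near 0^'+, a + t * b <= 0) -> a <= 0.
Proof.
move=> nle; have [[]//|ngt] := near0_sign a b.
have [t [+ /le_lt_trans h]] := filter_ex (filterI nle ngt).
by move=> /h; rewrite ltxx.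
Qed.

Lemma near0_neq0 a b : (a != 0) || (b != 0) ->
  \forall t \near 0^'+, a + t * b != 0.
Proof.
have [->|a0 _] := eqVneq a 0 => /= [b0|].
  by near=> t; rewrite add0r mulf_neq0// gt_eqF.
have [[aneg _]|h] := near0_sign a b; last first.
  by apply: filterS h => t /= /lt0r_neq0.
have {}a0 : a < 0 by rewrite lt_neqAle a0.
by apply: filterS (near0_lt0 b a0) => t /= /ltr0_neq0.
Unshelve. all: by end_near. Qed.

Lemma near0_interval (Q : set R) : (\forall t \near 0^'+, Q t) ->
  exists2 e, 0 < e & forall t, 0 < t < e -> Q t.
Proof.
rewrite near_withinE => /nbhs_ballP[e e0 h]; exists e => // t /andP[t0 te].
by apply: h => //; rewrite -ball_normE /ball_/= sub0r normrN gtr0_norm.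
Qed.

End Germs.

(** * Affine functions, polyhedra and convex functions along segments *)
Section Affine.
Context {R : realType} {d : nat}.
Local Notation point := 'rV[R]_d.
Implicit Types (P : set point) (a b f g : point -> R^o) (x y v : point).

Lemma linear_line (phi : {linear point -> R^o}) x v (t : R) :
  phi (x + t *: v) = (phi x : R) + t * phi v :> R.
Proof. by rewrite linearD linearZ. Qed.

Lemma affineE a x v (t : R) : affine_on setT a ->
  a (x + t *: v) = a x + t * (a (x + v) - a x) :> R.
Proof.
move=> [phi [c h]]; have {}h y : a y = (phi y : R) + c :> R by exact: h.
rewrite !h linear_line -[in phi (x + v)](scale1r v) linear_line mul1r.
by ring.
Qed.

Lemma affineB a b : affine_on setT a -> affine_on setT b ->
  affine_on setT (fun x => b x - a x).
Proof.
move=> ha hb; have := affine_onD (affine_onZ (-1) ha) hb.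
congr affine_on; apply/funext => x /=.
by rewrite addrC; congr (_ + _); rewrite /= [LHS]mulN1r.
Qed.

Lemma affineM a b (s t : R) : affine_on setT a -> affine_on setT b ->
  affine_on setT (fun x => s * a x + t * b x : R).
Proof.
by move=> ha hb; have := affine_onD (affine_onZ s ha) (affine_onZ t hb).
Qed.

Lemma affine_onE P f : affine_on P f ->
  exists a, affine_on setT a /\ forall x, P x -> f x = a x.
Proof.
by move=> [phi [c h]]; exists (fun x => phi x + c); split=> //; exists phi, c.
Qed.

(** The algebraic interior, which is what the arguments along segments use. *)
Definition core P y := forall v, \forall t \near 0^'+, P (y + t *: v).

Lemma core_mem P y : core P y -> P y.
Proof.
by move=> /(_ 0)/filter_ex[t]; rewrite scaler0 addr0.
Qed.

(** Each of the finitely many defining inequalities of P is eventually decided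
along the ray from x. The first alternative contains P x because the
inequalities are weak. *)
Lemma polyhedron_germ P x v : polyhedron P ->
  (P x /\ \forall t \near 0^'+, P (x + t *: v)) \/
  \forall t \near 0^'+, ~ P (x + t *: v).
Proof.
move=> [n [phi [b ->]]].
have E i t : (phi i (x + t *: v) : R) - b i = phi i x - b i + t * phi i v.
  by rewrite linear_line addrAC.
have [h|/existsNP[i]] := pselect (forall i, (phi i x - b i <= 0 :> R) /\
     \forall t \near 0^'+, (phi i x - b i : R) + t * phi i v <= 0).
  left; split=> [i|]; first by have [+ _] := h i; rewrite subr_le0.
  have : \forall t \near 0^'+, forall i, (phi i x - b i : R) + t * phi i v <= 0.
    by apply: filter_forall => i; have [] := h i.
  by apply: filterS => t ht i; rewrite -subr_le0 E.
have [//|h _] := near0_sign (phi i x - b i : R) (phi i v).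
by right; apply: filterS h => t ht /(_ i); rewrite -subr_le0 E leNgt ht.
Qed.

Definition convexfct f := forall x v (t : R), 0 <= t <= 1 ->
  f (x + t *: v) <= f x + t * (f (x + v) - f x) :> R.

Definition convexity_gap x v (t : R) f : R :=
  f x + t * (f (x + v) - f x) - f (x + t *: v).

Lemma convexfctP f : convex_function setT f <-> convexfct f.
Proof.
have E (t : {i01 R}) (x y : convex_lmodType point) :
    conv t x y = y + t%:inum *: (x - y : point) :> point.
  rewrite /conv/=/unstable.onem scalerBl scale1r scalerBr addrCA; congr (_ + _).
split=> [h x v t /andP[t0 t1]|h t x y _ _].
  have := h (Itv01 t0 t1) (x + v) x; rewrite !in_setT => /(_ isT isT).
  rewrite E/= addrAC subrr add0r => /le_trans; apply.
  by rewrite convRE /= /unstable.onem; lra.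
rewrite E (le_trans (h _ _ _ _))//; first by rewrite ge0 le1.
rewrite addrCA subrr addr0 convRE /= /unstable.onem; lra.
Qed.

Lemma convexfct_affine a : affine_on setT a -> convexfct a.
Proof. by move=> ha x v t _; rewrite affineE. Qed.

Lemma convexfct_comb f g (s t : R) : 0 <= s -> 0 <= t ->
  convexfct f -> convexfct g ->
  convexfct (fun x => s * f x + t * g x : R).
Proof.
move=> s0 t0 hf hg x v r r01 /=.
have := ler_wpM2l s0 (hf x v r r01); have := ler_wpM2l t0 (hg x v r r01); lra.
Qed.

(** On the ray from the interior point y towards x, the convex function starts
as a, and its slope can only grow. *)
Lemma convex_above_tangent P y a g :
  convexfct g -> affine_on setT a -> core P y ->
  (forall x, P x -> g x = a x) -> forall x, (a x <= g x :> R).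
Proof.
move=> hg ha cy ga x; near (0:R)^'+ => t.
have t0 : 0 < t by [].
have t1 : t <= 1 by near: t; exact: nbhs_right_le.
have Pt : P (y + t *: (x - y)) by near: t; apply: cy.
have := hg y (x - y) t; rewrite (ltW t0) t1 => /(_ isT).
rewrite (ga _ Pt) (ga _ (core_mem cy)) (affineE _ _ _ ha).
by rewrite lerD2l ler_pM2l// lerD2r addrC subrK.
Unshelve. all: by end_near. Qed.

(** An affine function that is nonnegative near an interior point where it
vanishes has slope 0 in every direction, as the opposite direction shows. *)
Lemma affine_touch P y a b : affine_on setT a -> affine_on setT b -> core P y ->
  (forall x, P x -> (a x <= b x :> R)) -> a y = b y -> a = b.
Proof.
move=> ha hb cy ab aby.
pose p x : R := b x - a x.
have hp : affine_on setT (p : point -> R^o) := affineB ha hb.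
have py : p y = 0 by rewrite /p aby subrr.
have p0 v : 0 <= p (y + v).
  near (0:R)^'+ => t; have t0 : 0 < t by [].
  have : 0 <= p (y + t *: v) by rewrite subr_ge0; apply: ab; near: t; apply: cy.
  by rewrite (affineE _ _ _ hp) py subr0 add0r pmulr_rge0.
apply/funext => x; apply/eqP; rewrite eq_sym -subr_eq0; apply/eqP.
have := p0 (x - y); have := p0 (- (x - y)); rewrite -[- (x - y)]scaleN1r.
rewrite (affineE _ _ _ hp) py addrCA subrr addr0 subr0 add0r mulN1r oppr_ge0.
by move=> h1 h2; apply: le_anti; apply/andP; split.
Unshelve. all: by end_near. Qed.

(** By induction: a small move from a point good for the previous functions
towards a point where the next one does not vanish keeps what was achieved. *)
Lemma generic_point (I : finType) (psi : I -> point -> R^o) :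
  (forall i, affine_on setT (psi i)) -> (forall i, exists x, psi i x != 0) ->
  exists x, forall i, psi i x != 0.
Proof.
move=> hpsi nz.
suff [x hx] : exists x, forall i, i \in enum I -> psi i x != 0.
  by exists x => i; apply: hx; rewrite mem_enum.
elim: (enum I) => [|i s [y hy]]; first by exists 0.
have [z hz] := nz i.
have hyz j : j \in i :: s ->
    \forall t \near (0:R)^'+, psi j (y + t *: (z - y)) != 0.
  rewrite inE => ijs; have : (psi j y != 0) || (psi j z - psi j y != 0).
    have [jy|//] := eqVneq (psi j y) 0.
    by case/orP: ijs => [/eqP eji|/hy]; rewrite ?jy ?eqxx// subr0 eji hz.
  move=> /near0_neq0; apply: filterS => t /=.
  by rewrite (affineE _ _ _ (hpsi j)) subrKC.
have /filter_ex[t ht] : \forall t \near (0:R)^'+,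
    forall j, j \in i :: s -> psi j (y + t *: (z - y)) != 0.
  apply: filter_forall => j; have [/hyz|_] := boolP (j \in i :: s).
    by apply: filterS.
  by near=> t.
by exists (y + t *: (z - y)).
Unshelve. all: by end_near. Qed.

Lemma generic_direction (I : finType) (psi : I -> point -> R^o) x :
  (forall i, affine_on setT (psi i)) -> (forall i, exists u, psi i u != 0) ->
  exists v, \forall t \near (0:R)^'+, forall i, psi i (x + t *: v) != 0.
Proof.
move=> hpsi nz; have [z hz] := generic_point hpsi nz; exists (z - x).
apply: filter_forall => i.
have /near0_neq0 : (psi i x != 0) || (psi i z - psi i x != 0).
  by have [ix|//] := eqVneq (psi i x) 0; rewrite ix subr0 hz.
by apply: filterS => t /=; rewrite (affineE _ _ _ (hpsi i)) subrKC.
Qed.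

End Affine.

(** * Small perturbations of convex piecewise affine functions *)
Section Cover.
Context {R : realType} {d : nat} {I : finType}.
Local Notation point := 'rV[R]_d.
Implicit Types (a b : I -> point -> R^o) (g w : point -> R^o) (x v : point).

(** What a walk along a segment uses of the full-dimensional cells of a
complex. *)
Record cell_cover (P : I -> set point) (y : I -> point) : Prop := CellCover {
  cell_polyhedron : forall i, polyhedron (P i) ;
  cell_core : forall i, core (P i) (y i) ;
  cell_covers : forall x, exists i, P i x
}.

(** The affine functions live on the whole space, so that those of different
cells can be compared anywhere. *)
Record extends (P : I -> set point) a g : Prop := Extends {
  extends_affine : forall i, affine_on setT (a i) ;
  extendsE : forall i x, P i x -> g x = a i x
}.

Context (P : I -> set point) (y : I -> point) (hP : cell_cover P y).

(** Finitely many polyhedra cover the ray, and each of them is eventually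
entered or left, so one contains an initial segment. *)
Lemma cover_germ x v :
  exists i, P i x /\ \forall t \near (0:R)^'+, P i (x + t *: v).
Proof.
have [//|/forallNP h] :=
  pselect (exists i, P i x /\ \forall t \near (0:R)^'+, P i (x + t *: v)).
have /filter_ex[t ht] : \forall t \near (0:R)^'+, forall i, ~ P i (x + t *: v).
  apply: filter_forall => i.
  by case: (polyhedron_germ x v (cell_polyhedron hP i)) => // /h.
by have [i /ht] := cell_covers hP (x + t *: v).
Qed.

Lemma extends_support a g i x : extends P a g -> convexfct g ->
  a i x <= g x :> R.
Proof.
move=> ha hg.
have [hai yi] := (extends_affine ha i, cell_core hP i).
by apply: (convex_above_tangent hg hai yi _ x) => z; exact: extendsE.
Qed.

Lemma convex_of_support a g : extends P a g ->
  (forall i x, a i x <= g x :> R) -> convexfct g.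
Proof.
move=> ha ag x v t /andP[t0 t1].
have [i hi] := cell_covers hP (x + t *: v).
rewrite (extendsE ha hi) (affineE _ _ _ (extends_affine ha i)).
have := ler_wpM2l t0 (ag i (x + v)).
have : 0 <= 1 - t by rewrite subr_ge0.
move=> /ler_wpM2l/(_ _ _ (ag i x)); lra.
Qed.

(** Inequalities that hold at generic points propagate to all points, by
letting generic points on a ray tend to its origin inside a single cell. *)
Lemma cover_limit a g (c : point -> R^o) x v :
  extends P a g -> affine_on setT c ->
  (\forall t \near (0:R)^'+, c (x + t *: v) <= g (x + t *: v) :> R) ->
  c x <= g x :> R.
Proof.
move=> ha hc cg; have [i [Pix Pit]] := cover_germ x v.
rewrite (extendsE ha Pix) -subr_le0.
have := affineB (extends_affine ha i) hc => hd.
apply: (@near0_le0 _ _ (c (x + v) - a i (x + v) - (c x - a i x))).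
apply: filterS (filterI cg Pit) => t /= [cgt Pt].
by rewrite -(affineE x v t hd) subr_le0 -(extendsE ha Pt).
Qed.

Lemma extendsD a b g w (s : R) : extends P a g -> extends P b w ->
  extends P (fun i x => a i x + s * b i x : R) (fun x => g x + s * w x : R).
Proof.
move=> ha hb; split=> [i|i x Px]; last first.
  by rewrite (extendsE ha Px) (extendsE hb Px).
have := affineM 1 s (extends_affine ha i) (extends_affine hb i).
by congr affine_on; apply/funext => x; rewrite mul1r.
Qed.

(** The affine function of the initial cell P i, perturbed by s, is pursued
along the segment from x to z: whenever the segment passes from a cell k to a
cell j, the perturbed affine function of j is at least that of k at z. The
third case of the hypothesis says that x and z are in general position: the
determinant vanishes if the segment, away from z, meets the common zeros of a
j - a k and b j - b k. *)
Lemma walk_dominates a b g w (s : R) i x z :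
  extends P a g -> extends P b w -> convexfct g -> P i x ->
  (forall k j, (forall u, b j u - b k u = 0 :> R) \/
     (exists lam, 0 <= 1 + s * lam /\
        forall u, b j u - b k u = lam * (a j u - a k u) :> R) \/
     ((a j x - a k x) * (b j z - b k z) - (b j x - b k x) * (a j z - a k z)
       != 0 :> R)) ->
  a i z + s * b i z <= g z + s * w z :> R.
Proof.
move=> ha hb hg Pix dich.
pose c k u : R := a k u + s * b k u.
have hc := extendsD s ha hb; rewrite -/(c i z).
pose v := z - x.
(* S is the set of times at which the segment is in a cell whose perturbed
   affine function is already known to dominate that of P i at z. *)
pose S := [set r : R | 0 <= r <= 1 /\
  exists k, c i z <= c k z /\ P k (x + r *: v)].
have S0 : S 0 by split; [rewrite lexx ler01|exists i; rewrite scale0r addr0].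
have supS : has_sup S.
  by split; [exists 0|exists 1 => r [/andP[]]].
pose r := sup S.
have r0 : 0 <= r by apply: sup_upper_bound.
have r1 : r <= 1 by apply: ge_sup; [exists 0|move=> q [/andP[]]].
pose x' := x + r *: v.
(* The supremum is attained: otherwise all good cells would avoid a short
   interval that ends at time r. *)
have [k [ck Pk]] : exists k, c i z <= c k z /\ P k x'.
  have [//|/forallNP nk] := pselect (exists k, c i z <= c k z /\ P k x').
  have : \forall t \near (0:R)^'+, forall k, c i z <= c k z ->
      ~ P k (x' + t *: - v).
    apply: filter_forall => k; have [ck|] := leP (c i z) (c k z).
      case: (polyhedron_germ x' (- v) (cell_polyhedron hP k)) => [[Pk _]|].
        by case: (nk k).
      by apply: filterS.
    by move=> h; near=> t.
  move=> /near0_interval[e e0 he].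
  have [q [q01 [k [ck Pk]]] eq] := sup_adherent e0 supS.
  have := sup_upper_bound supS (conj q01 (ex_intro _ k (conj ck Pk))).
  rewrite -/r le_eqVlt => /orP[/eqP qr|qr].
    by exists k; split=> //; rewrite /x' -qr.
  case: (he (r - q) _ k ck).
    by rewrite subr_gt0 qr/= -/r ltrBlDl -ltrBlDr.
  by rewrite scalerN /x' -addrA -scalerBl subKr.
have zE : z = x' + (1 - r) *: v.
  by rewrite /x' -addrA -scalerDl subrKC scale1r /v subrKC.
have xE : x = x' + (- r) *: v by rewrite /x' scaleNr addrK.
have [r1'|] := ltP r 1; last first.
  move=> r1'; have re : r = 1 by apply: le_anti; rewrite r1 r1'.
  move: Pk; have -> : x' = z by rewrite zE re subrr scale0r addr0.
  by move=> Pk; have -> : g z + s * w z = c k z :> R := extendsE hc Pk.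
have [j [Pj Pjt]] := cover_germ x' v.
pose p u : R := a j u - a k u; pose q u : R := b j u - b k u.
have hp : affine_on setT (p : point -> R^o).
  exact: affineB (extends_affine ha k) (extends_affine ha j).
have hq : affine_on setT (q : point -> R^o).
  exact: affineB (extends_affine hb k) (extends_affine hb j).
have p0 : p x' = 0 by rewrite /p -(extendsE ha Pj) -(extendsE ha Pk) subrr.
have q0 : q x' = 0 by rewrite /q -(extendsE hb Pj) -(extendsE hb Pk) subrr.
have pE t : p (x' + t *: v) = t * p (x' + v).
  by rewrite (affineE _ _ _ hp) p0 subr0 add0r.
have qE t : q (x' + t *: v) = t * q (x' + v).
  by rewrite (affineE _ _ _ hq) q0 subr0 add0r.
(* Just after the crossing the segment is in P j, where a j = g >= a k; since p
   vanishes at the crossing, its sign persists up to z. *)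
have pz : 0 <= p z.
  rewrite zE pE mulr_ge0//; first by rewrite subr_ge0.
  near (0:R)^'+ => t; have t0 : 0 < t by [].
  rewrite -(pmulr_rge0 _ t0) -pE subr_ge0.
  have Pt : P j (x' + t *: v) by near: t.
  by rewrite -(extendsE ha Pt) extends_support.
have cj : c i z <= c j z.
  apply: le_trans ck _; rewrite -subr_ge0.
  have -> : c j z - c k z = p z + s * q z by rewrite /c /p /q; ring.
  have [h|[[lam [lam0 h]]|]] := dich k j.
  - by rewrite /q h mulr0 addr0.
  - by rewrite /q h -/(p z) mulrA -[X in X + _]mul1r -mulrDl mulr_ge0.
  - rewrite -/(p x) -/(q z) -/(q x) -/(p z) xE zE !pE !qE.
    by rewrite mulrACA [X in _ - X]mulrACA [X in _ - _ * X]mulrC subrr eqxx.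
near (0:R)^'+ => t; have t0 : 0 < t by [].
have : S (r + t).
  split; last first.
    exists j; split => //; rewrite scalerDl addrA; near: t; exact: Pjt.
  rewrite addr_ge0 ?(ltW t0)//= -lerBrDl; near: t; apply: nbhs_right_le.
  by rewrite subr_gt0.
move/(sup_upper_bound supS); rewrite -/r => /(lt_le_trans _) h.
by have := h r; rewrite ltrDl t0 ltxx => /(_ isT).
Unshelve. all: by end_near. Qed.

(** If q = b j - b k is lam times p = a j - a k, then p + s q = (1 + s lam) p,
and the bound on s makes all the finitely many factors 1 + s lam nonnegative.
The pairs with p = 0 have q = 0 by hypothesis. For the other pairs general
position is reached in two steps: x is chosen near y i with p x != 0, after
which the determinant in [walk_dominates] is a nonzero affine function of z.
*)
Lemma convex_perturb a b g w : extends P a g -> extends P b w -> convexfct g ->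
  (forall i j, a i = a j -> b i = b j) ->
  exists2 e : R, 0 < e & forall s, `|s| <= e ->
    convexfct (fun x => g x + s * w x : R).
Proof.
move=> ha hb hg hab.
pose p k j u : R := a j u - a k u; pose q k j u : R := b j u - b k u.
have hp k j : affine_on setT (p k j : point -> R^o).
  exact: affineB (extends_affine ha k) (extends_affine ha j).
have hq k j : affine_on setT (q k j : point -> R^o).
  exact: affineB (extends_affine hb k) (extends_affine hb j).
have h1 : affine_on setT ((fun=> 1 : R) : point -> R^o).
  by exists \0, 1 => x _; rewrite add0r.
pose dep k j lam := forall u, q k j u = lam * p k j u.
pose lam k j : R := xget 0 (dep k j).
pose M := \sum_k \sum_j `|lam k j|.
have M0 : 0 <= M by apply: sumr_ge0 => k _; apply: sumr_ge0.
have lamM k j : `|lam k j| <= M.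
  rewrite /M (bigD1 k)//= (bigD1 j)//= -addrA lerDl addr_ge0 ?sumr_ge0// => l _.
  exact: sumr_ge0.
have M1 : 0 < 1 + M by rewrite ltr_wpDr.
exists (1 + M)^-1; first by rewrite invr_gt0.
move=> s; rewrite -[leRHS]mul1r ler_pdivlMr// => hs.
have lam_ge0 k j : 0 <= 1 + s * lam k j.
  have : `|s * lam k j| <= 1.
    rewrite normrM; apply: le_trans hs; rewrite ler_wpM2l//.
    by rewrite (le_trans (lamM k j))// lerDr.
  by rewrite ler_norml => /andP[+ _]; rewrite -lerBlDl sub0r.
have hc := extendsD s ha hb.
apply: (convex_of_support hc) => i z.
(* Pairs that impose no condition are given a function without zeros. *)
pose psi (kj : I * I) : point -> R^o :=
  if `[< a kj.1 = a kj.2 >] then (fun=> 1 : R) else p kj.1 kj.2.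
have [v hv] : exists v, \forall t \near (0:R)^'+,
    forall kj, psi kj (y i + t *: v) != 0.
  apply: generic_direction => -[k j]; rewrite /psi/=; case: asboolP => akj;
    [exact: h1|exact: hp|by exists 0; exact: (@oner_neq0 R)|].
  have [//|/forallNP h] := pselect (exists u, p k j u != 0).
  case: akj; apply/funext => u; have /negP := h u; rewrite negbK subr_eq0.
  by move/eqP.
have [t [ht Pt]] := filter_ex (filterI hv (cell_core hP i v)).
set x := y i + t *: v in ht Pt.
pose psi2 (kj : I * I) : point -> R^o :=
  if `[< exists l, dep kj.1 kj.2 l >] then (fun=> 1 : R)
  else (fun u =>
    p kj.1 kj.2 x * q kj.1 kj.2 u + - q kj.1 kj.2 x * p kj.1 kj.2 u : R).
have [v' hv'] : exists v', \forall t \near (0:R)^'+,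
    forall kj, psi2 kj (z + t *: v') != 0.
  apply: generic_direction => -[k j]; rewrite /psi2/=; case: asboolP => nd;
    [exact: h1|exact: affineM (hq k j) (hp k j)
    |by exists 0; exact: (@oner_neq0 R)|].
  have px : p k j x != 0.
    have := ht (k, j); rewrite /psi/=; case: asboolP => // akj _.
    by case: nd; exists 0 => u; rewrite /q (hab _ _ akj) subrr mul0r.
  have [//|/forallNP h] := pselect (exists u,
    p k j x * q k j u + - q k j x * p k j u != 0 :> R).
  case: nd; exists (q k j x / p k j x) => u.
  have /negP := h u; rewrite negbK mulNr subr_eq0 => /eqP e.
  by apply: (mulfI px); rewrite e mulrA; congr (_ * _); field.
have hci := extends_affine hc i; apply: (cover_limit hc hci).
apply: filterS hv' => t' hz; apply: (walk_dominates ha hb hg Pt) => k j.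
have := hz (k, j); rewrite /psi2/=; case: asboolP => [ex _|nd h].
  right; left; exists (lam k j); split=> // u.
  by have := xgetPex 0 ex; apply.
right; right; apply: contraNN h => /eqP h0; apply/eqP; rewrite mulNr; exact: h0.
Qed.

End Cover.

(** * Full-dimensional polyhedra and faces *)
Section Polyhedra.
Context {R : realType} {d : nat}.
Local Notation point := 'rV[R]_d.
Implicit Types (P F : set point) (a b f g psi : point -> R^o) (x y v : point).

Definition midpoint_closed P :=
  forall x y, P x -> P y -> P (x + 2^-1 *: (y - x)).

Lemma affine_mid a x y : affine_on setT a ->
  a (x + 2^-1 *: (y - x)) = (a x + a y) / 2 :> R.
Proof. by move=> ha; rewrite (affineE _ _ _ ha) subrKC; field. Qed.

(** A relative interior point: midpoints of points that make single
inequalities strict make all of them strict at once. *)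
Lemma strict_point (I : finType) (psi : I -> point -> R^o) (Q : I -> Prop) P :
  midpoint_closed P -> P !=set0 -> (forall i, affine_on setT (psi i)) ->
  (forall i x, P x -> (psi i x <= 0 :> R)) ->
  (forall i, Q i -> exists2 x, P x & (psi i x < 0 :> R)) ->
  exists2 x, P x & forall i, Q i -> (psi i x < 0 :> R).
Proof.
move=> hP [x0 Px0] ha le0 hQ.
suff [x Px hx] : exists2 x, P x &
    forall i, i \in enum I -> Q i -> (psi i x < 0 :> R).
  by exists x => // i; apply: hx; rewrite mem_enum.
elim: (enum I) => [|i s [y Py hy]]; first by exists x0.
have [/hQ[z Pz iz]|nQ] := pselect (Q i); last first.
  by exists y => // j; rewrite inE => /orP[/eqP->//|/hy].
exists (y + 2^-1 *: (z - y)); first exact: hP.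
move=> j js Qj; rewrite (affine_mid _ _ (ha j)).
have := le0 j _ Py; have := le0 j _ Pz.
move: js; rewrite inE => /orP[/eqP->|/hy/(_ Qj)]; lra.
Qed.

Lemma affine_hull_eq0 psi P x : affine_on setT psi ->
  (forall y, P y -> psi y = 0) -> affine_hull P x -> psi x = 0.
Proof.
move=> [phi [c h]] P0 [n [p [l [Pp l1 ->]]]].
have {}h y : psi y = (phi y : R) + c :> R by exact: h.
rewrite h linear_sum /= (eq_bigr (fun i => l i * - c)); last first.
  move=> i _; rewrite linearZ /=; congr (_ * _).
  by apply/eqP; rewrite -addr_eq0; have := P0 _ (Pp i); rewrite h => ->.
by rewrite -mulr_suml l1 mul1r addNr.
Qed.

Lemma has_dim_full P : has_dim P d <-> affine_hull P = setT.
Proof.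
have dimT : \dim {: point} = d by rewrite dimvf /dim/= mul1n.
split=> [[x0 [U [dU ->]]]|hP].
  apply/seteqP; split=> // x _ /=.
  have -> : U = fullv by apply/eqP; rewrite eqEdim subvf/= dimT dU.
  exact: memvf.
exists 0, fullv; split=> //; rewrite hP; apply/seteqP; split=> // x _ /=.
exact: memvf.
Qed.

Lemma affine_hull_mono P F : P `<=` F -> affine_hull P `<=` affine_hull F.
Proof.
move=> PF x [n [p [l [Pp l1 ->]]]]; exists n, p, l; split=> // i.
exact: PF.
Qed.

Lemma full_sub P F : P `<=` F -> has_dim P d -> has_dim F d.
Proof.
move=> PF /has_dim_full hP; apply/has_dim_full/seteqP; split=> // x _.
by apply: (affine_hull_mono PF); rewrite hP.
Qed.

Lemma full_affine_eq P a b : has_dim P d -> affine_on setT a ->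
  affine_on setT b -> (forall x, P x -> a x = b x) -> a = b.
Proof.
move=> /has_dim_full hP ha hb ab; apply/funext => x.
have := @affine_hull_eq0 _ P x (affineB hb ha); rewrite hP => h.
apply/eqP; rewrite -subr_eq0; apply/eqP/h => // z Pz.
by rewrite ab// subrr.
Qed.

Lemma full_nonempty P : has_dim P d -> P !=set0.
Proof.
move=> /has_dim_full hP; have : affine_hull P 0 by rewrite hP.
move=> [[|n] [p [l [Pp l1 _]]]]; last by exists (p ord0); exact: Pp.
by move: l1; rewrite big_ord0 => /esym/eqP; rewrite oner_eq0.
Qed.

Lemma polyhedron_affineP P : polyhedron P <->
  exists n (psi : 'I_n -> point -> R^o), (forall i, affine_on setT (psi i)) /\
    P = [set x | forall i, (psi i x <= 0 :> R)].
Proof.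
split=> [[n [phi [b ->]]]|[n [psi [hpsi ->]]]].
  exists n, (fun i x => phi i x - b i : R); split.
    by move=> i; exists (phi i), (- b i).
  by apply/seteqP; split=> x /= h i; have := h i; rewrite subr_le0.
have [phi h] := choice hpsi; have [c {}h] := choice h.
have {}h i y : psi i y = (phi i y : R) + c i :> R by exact: h.
exists n, phi, (fun i => - c i); apply/seteqP; split=> x /= hx i.
  by have := hx i; rewrite h -lerBrDr sub0r.
by have := hx i; rewrite h -[in X in _ -> X]lerBrDr sub0r.
Qed.

Lemma polyhedron_fin (I : finType) (psi : I -> point -> R^o) :
  (forall i, affine_on setT (psi i)) ->
  polyhedron [set x | forall i, (psi i x <= 0 :> R)].
Proof.
move=> hpsi; apply/polyhedron_affineP.
exists #|I|, (fun k => psi (enum_val k)); split=> [k//|].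
apply/seteqP; split=> x /= h i; first exact: h.
by rewrite -(enum_rankK i).
Qed.

Lemma polyhedron_midpoint P : polyhedron P -> midpoint_closed P.
Proof.
move=> /polyhedron_affineP[n [psi [hpsi ->]]] x y hx hy i.
by rewrite (affine_mid _ _ (hpsi i)); have := hx i; have := hy i; lra.
Qed.

(** An inequality that is nowhere strict on P is an equality on the affine
hull of P, hence everywhere; the other ones are strict at a common point. *)
Lemma full_core P : polyhedron P -> has_dim P d -> exists y, core P y.
Proof.
move=> polP dP; have := polyhedron_midpoint polP.
have ne := full_nonempty dP.
move: polP dP ne => /polyhedron_affineP[n [psi [hpsi ->]]].
set P' := [set x | _] => dP ne mid.
have le0 i x : P' x -> psi i x <= 0 :> R by apply.
have [|y Py hy] := strict_point (Q := fun i =>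
    exists2 x, P' x & (psi i x < 0 :> R)) mid ne hpsi le0; first by [].
exists y => v; apply: filter_forall => i.
have [/hy iy|ni] := pselect (exists2 x, P' x & (psi i x < 0 :> R)).
  apply: filterS (near0_lt0 (psi i (y + v) - psi i y) iy) => t /= /ltW.
  by rewrite (affineE _ _ _ (hpsi i)).
have psi0 x : psi i x = 0.
  apply: (@affine_hull_eq0 _ P' x (hpsi i)); last first.
    by move/has_dim_full: dP => ->.
  move=> z Pz; apply/eqP; have := le0 i _ Pz; rewrite le_eqVlt.
  by case/orP=> // iz; case: ni; exists z.
by near=> t; rewrite psi0.
Unshelve. all: by end_near. Qed.

Lemma face_affineP P F : face P F <-> exists psi : point -> R^o,
  [/\ affine_on setT psi, forall x, P x -> (psi x <= 0 :> R) &
      F = P `&` [set x | psi x = 0]].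
Proof.
split=> [[phi [c [h ->]]]|[psi [[phi [c h]] le0 ->]]].
  exists (fun x => phi x - c : R); split.
  - by exists phi, (- c).
  - by move=> x /h; rewrite -subr_le0.
  - congr (_ `&` _); apply/seteqP; split=> x /=.
      by move=> ->; rewrite subrr.
    by move/eqP; rewrite subr_eq0 => /eqP.
have {}h y : psi y = (phi y : R) + c :> R by exact: h.
exists phi, (- c); split.
  by move=> x /le0; rewrite h -lerBrDr sub0r.
congr (_ `&` _); apply/seteqP; split=> x /=; rewrite h.
  by move/eqP; rewrite addr_eq0 => /eqP.
by move=> ->; rewrite addNr.
Qed.

Lemma face_set0 P : face P set0.
Proof.
apply/face_affineP; exists (fun=> -1 : R); split.
- by exists \0, (-1) => x _; rewrite add0r.
- by move=> x _; rewrite lerN10.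
- by apply/seteqP; split=> // x [_ /= /eqP]; rewrite oppr_eq0 oner_eq0.
Qed.

Lemma affine_sum (I : finType) (J : pred I) (psi : I -> point -> R^o) :
  (forall i, affine_on setT (psi i)) ->
  affine_on setT (fun x => \sum_(i | J i) psi i x).
Proof.
move=> hpsi; have -> : (fun x => \sum_(i | J i) psi i x) = \sum_(i | J i) psi i.
  by apply/funext => x; rewrite fct_sumE.
apply: (big_ind (affine_on setT)) => //; first exact: affine_on0.
by move=> *; exact: affine_onD.
Qed.

End Polyhedra.

(** * The cells of a complex and the regions of a convex function *)
Section Complexes.
Context {R : realType} {d : nat}.
Local Notation point := 'rV[R]_d.
Implicit Types (C : set (set point)) (P F : set point) (f g w : point -> R^o).

(** By purity, it suffices to find an inclusion-maximal cell above F: one that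
contains the largest number of cells. *)
Lemma sub_full_cell C F : polyhedral_complex C -> C F ->
  exists2 P, full_cells C P & F `<=` P.
Proof.
move=> hC CF.
have [n /card_esym/card_set_bijP[e' [eC _ esurj]]] := complex_finite hC.
pose e : nat -> set point := e'; rewrite -/e in eC esurj.
have [k kn ek] := esurj _ CF.
pose down (i : 'I_n) := #|[pred j : 'I_n | `[< e j `<=` e i >]]|.
have Fk : `[< F `<=` e (Ordinal kn) >] by apply/asboolP; rewrite /= ek.
have [i /asboolP Fi imax] :=
  @arg_maxnP _ _ (fun i : 'I_n => `[< F `<=` e i >]) down Fk.
exists (e i) => //; have Ci : C (e i) by apply: eC => /=.
split=> //; apply: (complex_pure hC) => // Q CQ iQ.
have [l ln el] := esurj _ CQ.
have := imax (Ordinal ln); rewrite /= el => /(_ _)/wrap[].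
  by apply/asboolP => x /Fi/iQ.
rewrite leqNgt => /negP nlt; apply/seteqP; split=> //.
apply: contrapT => nQi; apply: nlt; apply/proper_card/properP; split.
  apply/fintype.subsetP => j ji; apply/asboolP.
  move/asboolP: ji => ji x /ji/=.
  by rewrite el => /iQ.
exists (Ordinal ln); first exact/asboolP.
by apply/asboolPn; rewrite /= el.
Qed.

Lemma enum_full_cells C n : polyhedral_complex C -> full_cells C #= `I_n ->
  exists (P : 'I_n -> set point) (y : 'I_n -> point),
    [/\ cell_cover P y, injective P, forall i, full_cells C (P i) &
        forall F, C F -> exists i, F `<=` P i].
Proof.
move=> hC /card_esym/card_set_bijP[e' [eC einj esurj]].
pose e : nat -> set point := e'; rewrite -/e in eC einj esurj.
have eF (i : 'I_n) : full_cells C (e i) by apply: eC => /=.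
have [y hy] : {y : 'I_n -> point & forall i : 'I_n, core (e i) (y i)}.
  apply: (@choice _ _ (fun (i : 'I_n) z => core (e i) z)) => i.
  have [Ci di] := eF i; exact: full_core (complex_polyhedron hC Ci) di.
have sub F : C F -> exists i : 'I_n, F `<=` e i.
  move=> /(sub_full_cell hC)[P CP FP]; have [k kn ek] := esurj _ CP.
  by exists (Ordinal kn); rewrite /= ek.
exists (fun i => e i), y; split=> //; last first.
  by move=> i j /einj ij; apply: val_inj; apply: ij; rewrite inE/=.
split=> // [i|x].
  by have [Ci _] := eF i; exact: complex_polyhedron Ci.
have : [set: point] x by []; rewrite -(complex_complete hC) => -[F CF Fx].
by have [i Fi] := sub _ CF; exists i; exact: Fi.
Qed.

Lemma compatible_extends (I : finType) C (P : I -> set point) f :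
  (forall i, C (P i)) -> compatible C f -> exists a, extends P a f.
Proof.
move=> CP hf.
have [a h] := choice (fun i => affine_onE (hf _ (CP i))).
by exists a; split=> i; case: (h i).
Qed.

Section Regions.
Context {n : nat} (P : 'I_n -> set point) (y : 'I_n -> point).
Context (a : 'I_n -> point -> R^o) (g : point -> R^o).
Hypotheses (hP : cell_cover P y) (dP : forall i, has_dim (P i) d).
Hypotheses (ha : extends P a g) (hg : convexfct g).

(** Since g is the maximum of the a i, for nonempty J these are the cells of
the coarsest complex compatible with g, together with their faces. *)
Definition region (J : {set 'I_n}) : set point :=
  [set x | forall j, j \in J -> a j x = g x].

Definition region_complex : set (set point) :=
  [set F | F = set0 \/ exists2 J : {set 'I_n}, J != finset.set0 & F = region J].

Let le_g i x : a i x <= g x :> R := extends_support hP i x ha hg.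
Let aff i := extends_affine ha i.

Lemma region1 j : region [set j]%SET = [set x | a j x = g x].
Proof.
apply/seteqP; split=> x /= h; first by apply: h; rewrite inE.
by move=> k; rewrite inE => /eqP->.
Qed.

Lemma argmaxP j x : a j x = g x <-> forall k, a k x - a j x <= 0 :> R.
Proof.
split=> [-> k|h]; first by rewrite subr_le0.
apply/le_anti/andP; split; first exact: le_g.
have [i Pi] := cell_covers hP x; rewrite (extendsE ha Pi).
by have := h i; rewrite subr_le0.
Qed.

Lemma region_polyhedron J : polyhedron (region J).
Proof.
pose psi (jk : 'I_n * 'I_n) : point -> R^o :=
  if jk.1 \in J then (fun x => a jk.2 x - a jk.1 x : R) else (fun=> 0 : R).
have -> : region J = [set x | forall jk, (psi jk x <= 0 :> R)].
  apply/seteqP; split=> x /= h.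
    move=> [j k]; rewrite /psi/=; case: ifP => // jJ.
    by move/argmaxP: (h j jJ); apply.
  by move=> j jJ; apply/argmaxP => k; have := h (j, k); rewrite /psi/= jJ.
apply: polyhedron_fin => -[j k]; rewrite /psi/=; case: ifP => _.
  exact: affineB.
by exists \0, 0 => x _; rewrite addr0.
Qed.

(** A nonempty face F is the region of the set K of all indices active on the
whole of F. Indeed, let z be a point of F where no other index is active. For
x in region K, the segment from x to z can be prolonged a little beyond z
inside region J, so an affine function that is at most 0 on region J and
vanishes at z must vanish at x. *)
Lemma region_face J F : J != finset.set0 -> face (region J) F ->
  F !=set0 -> exists2 K : {set 'I_n}, K != finset.set0 & F = region K.
Proof.
move=> /set0Pn[j0 j0J] /face_affineP[psi [hpsi le0 FE]] neF.
pose K : {set 'I_n} := [set k | `[< forall x, F x -> a k x = g x >]]%SET.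
have FJ : F `<=` region J by rewrite FE => x [].
have JK j : j \in J -> j \in K.
  by move=> jJ; rewrite inE; apply/asboolP => x /FJ/(_ j jJ).
exists K; first by apply/set0Pn; exists j0; exact: JK.
have FK : F `<=` region K.
  by move=> x Fx k; rewrite inE => /asboolP; apply.
apply/seteqP; split=> // x Kx.
have Jx : region J x by move=> j /JK/Kx.
rewrite FE; split=> //=.
pose chi k u : R := a k u - a j0 u.
have hchi k : affine_on setT (chi k : point -> R^o) by exact: affineB.
have chi_le0 k u : F u -> chi k u <= 0.
  by move=> Fu; have /argmaxP := FJ _ Fu _ j0J; apply.
have midF : midpoint_closed F.
  move=> u v; rewrite FE => -[Ju /= pu] [Jv /= pv]; split.
    exact: (polyhedron_midpoint (region_polyhedron J)).
  by rewrite /= (affine_mid _ _ hpsi) pu pv addr0 mul0r.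
(* z is a point of F at which only the indices in K are active. *)
have [|z Fz hz] :=
  strict_point (Q := fun k => k \notin K) midF neF hchi chi_le0.
  move=> k; rewrite inE => /asboolPn/existsNP[u /not_implyP[Fu nu]].
  exists u => //; rewrite lt_neqAle chi_le0// andbT subr_eq0.
  by apply/eqP; rewrite (FJ _ Fu _ j0J).
have [t [t0 ht]] : exists t : R, 0 < t /\ region J (z + t *: (z - x)).
  have : \forall t \near (0:R)^'+, forall k, chi k (z + t *: (z - x)) <= 0.
    apply: filter_forall => k; have [kK|/hz zk] := boolP (k \in K); last first.
      have := near0_lt0 (chi k (z + (z - x)) - chi k z) zk.
      apply: filterS => t /= /ltW.
      by rewrite (affineE _ _ _ (hchi k)).
    have ck u : region K u -> chi k u = 0.
      by move=> Ku; rewrite /chi (Ku _ kK) (Ku _ (JK _ j0J)) subrr.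
    near=> t; rewrite (_ : z + _ = z + (- t) *: (x - z)); last first.
      by rewrite scaleNr -scalerN opprB.
    by rewrite (affineE _ _ _ (hchi k)) subrKC !ck ?subrr ?mulr0 ?addr0//;
      exact: FK.
  move=> near_chi; near (0:R)^'+ => t; exists t; split=> //.
  have ht : forall k, chi k (z + t *: (z - x)) <= 0 by near: t.
  have g0 : a j0 (z + t *: (z - x)) = g (z + t *: (z - x)) by exact/argmaxP.
  move=> j jJ; rewrite -g0.
  have eqj u : region K u -> a j u = a j0 u.
    by move=> Ku; rewrite (Ku _ (JK _ jJ)) (Ku _ (JK _ j0J)).
  rewrite (_ : z + _ = z + (- t) *: (x - z)); last first.
    by rewrite scaleNr -scalerN opprB.
  by rewrite (affineE _ _ _ (aff j)) (affineE _ _ _ (aff j0)) subrKC !eqj//;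
    exact: FK.
have pz : psi z = 0 by move: Fz; rewrite FE => -[].
have := le0 _ ht; rewrite (_ : z + _ = z + (- t) *: (x - z)); last first.
  by rewrite scaleNr -scalerN opprB.
rewrite (affineE _ _ _ hpsi) subrKC pz subr0 add0r mulNr oppr_le0 pmulr_rge0//.
by move=> px; apply/le_anti/andP; split=> //; exact: le0.
Unshelve. all: by end_near. Qed.

(** The face is exposed by the sum of the a k - a j0 for k in K and a fixed j0
in J: a sum of nonpositive terms vanishes only if all of them do. *)
Lemma region_meet J K : J != finset.set0 ->
  face (region J) (region J `&` region K).
Proof.
move=> /set0Pn[j0 j0J]; apply/face_affineP.
exists (fun x => \sum_(k in K) (a k x - a j0 x) : R).
have term_le0 x k : region J x -> a k x - a j0 x <= 0 :> R.
  by move=> Jx; have /argmaxP := Jx _ j0J; apply.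
split.
- by apply: affine_sum => k; exact: affineB.
- by move=> x Jx; apply: sumr_le0 => k _; exact: term_le0.
- apply/seteqP; split=> x [Jx Kx]; split=> //=.
    by apply: big1 => k kK; rewrite (Kx _ kK) (Jx _ j0J) subrr.
  move=> k kK; rewrite -(Jx _ j0J); apply/eqP; rewrite -subr_eq0.
  move/eqP: Kx; rewrite -oppr_eq0 -sumrN psumr_eq0.
    by move=> /allP/(_ k); rewrite mem_index_enum kK oppr_eq0; apply.
  by move=> i _; rewrite oppr_ge0 term_le0.
Qed.

Lemma cell_sub_region i : P i `<=` region [set i]%SET.
Proof. by move=> x Px; rewrite region1/= (extendsE ha Px). Qed.

Lemma region_complexP : polyhedral_complex region_complex.
Proof.
split.
- apply: (@sub_finite_set _ _ (set0 |` (region @` setT))).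
    by move=> F [->|[J _ ->]]; [left|right; exists J].
  by rewrite finite_setU; split; [exact: finite_set1|exact: finite_image].
- move=> F [->|[J _ ->]]; last exact: region_polyhedron.
  apply/polyhedron_affineP; exists 1%N, (fun=> fun=> 1 : R); split.
    by move=> _; exists \0, 1 => x _; rewrite add0r.
  by apply/seteqP; split=> // x /= /(_ ord0); rewrite ler10.
- by left.
- move=> G F [->|[J J0 ->]] hF.
    by move: hF => [phi [c [_ ->]]]; left; rewrite set0I.
  have [neF|/set0P/negP/negPn/eqP] := pselect (F !=set0); last by left.
  by right; exact: region_face hF neF.
- have meet F G : region_complex F -> region_complex G -> face F (F `&` G).
    move=> [->|[J J0 ->]] [->|[K K0 ->]]; rewrite ?set0I ?setI0;
      [exact: face_set0..|exact: region_meet].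
  by move=> F G hF hG; split; [|rewrite setIC]; exact: meet.
- move=> F hF Fmax.
  have cell i : F `<=` region [set i]%SET -> has_dim F d.
    move=> Fi; rewrite -(Fmax (region [set i]%SET)) //.
      exact: full_sub (cell_sub_region (i := i)) (dP i).
    by right; exists [set i]%SET => //; apply/set0Pn; exists i; rewrite inE.
  case: hF => [F0|[J /set0Pn[j jJ] FJ]]; last first.
    by apply: (cell j); rewrite FJ => x Jx k; rewrite inE => /eqP->; exact: Jx.
  have [i _] := cell_covers hP 0.
  by apply: (cell i); rewrite F0.
- apply/seteqP; split=> // x _; have [i Pi] := cell_covers hP x.
  exists (region [set i]%SET); last exact: cell_sub_region.
  by right; exists [set i]%SET => //; apply/set0Pn; exists i; rewrite inE.
Qed.

Lemma region_compatible : compatible region_complex g.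
Proof.
move=> F [->|[J /set0Pn[j jJ] ->]]; first by exists \0, 0.
have [phi [c h]] := aff j; exists phi, c => x Jx.
by rewrite -(Jx _ jJ) h.
Qed.

(** If region J is full-dimensional, then the affine functions indexed by J
agree on it, hence everywhere. *)
Lemma full_region F : full_cells region_complex F ->
  exists j, F = region [set j]%SET.
Proof.
move=> [[->|[J /set0Pn[j jJ] ->]]] dF.
  by have [] := full_nonempty dF.
exists j; apply/seteqP; split=> x hx k.
  by rewrite inE => /eqP->; exact: hx.
move=> kJ; rewrite (_ : a k = a j); first by apply: hx; rewrite inE.
by apply: (full_affine_eq dF) => // z Jz; rewrite !Jz.
Qed.

(** The full-dimensional cells of the complex of regions are among the regions
of single indices, and the indices i and j give the same one. *)
Lemma fewer_pieces i j : i != j -> a i = a j -> (npieces g < n)%N.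
Proof.
move=> ij aij.
have card_le : full_cells region_complex #<= `I_n.-1.
  rewrite (card_le_eqr card_II).
  apply: card_le_trans
    (card_image_le (fun k => region [set lift i k]%SET) setT).
  apply: subset_card_le => F /full_region[k ->].
  have [l ->|->] := unliftP i k; first by exists l.
  have [l jE|jE] := unliftP i j; last by rewrite jE eqxx in ij.
  by exists l => //; rewrite -jE !region1 aij.
have [m hm] : exists m, full_cells region_complex #= `I_m.
  by apply/finite_setP/finite_set_leP; exists n.-1.
have [|_ /(_ m) nm] := npiecesP (f := g).
  exists region_complex.
  by split; [exact: region_complexP|exact: region_compatible].
have {}nm : (npieces g <= m)%N.
  by apply: nm; exists region_complex; split=> //;
     [exact: region_complexP|exact: region_compatible].
apply: (leq_ltn_trans nm).
have : (m <= n.-1)%N by rewrite -card_le_II -(card_le_eql hm).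
by move=> /leq_ltn_trans; apply; rewrite prednK// (leq_ltn_trans _ (ltn_ord i)).
Qed.

End Regions.

End Complexes.

(** * Moving a convex function along a line *)
Section Directions.
Context {R : realType} {d : nat}.
Local Notation point := 'rV[R]_d.
Implicit Types (C D : set (set point)) (P F : set point).
Implicit Types (f g h w : point -> R^o).

Definition along g w (s : R) : point -> R^o := fun x => g x + s * w x : R.

Definition perturbable g w := exists2 e : R, 0 < e &
  forall s, `|s| <= e -> convexfct (along g w s).

Lemma along0 g w : along g w 0 = g.
Proof. by apply/funext => x; rewrite /along mul0r addr0. Qed.

Lemma perturbable_convex g w : perturbable g w -> convexfct g.
Proof.
by move=> [e e0 he]; rewrite -(along0 g w); apply: he; rewrite normr0 ltW.
Qed.

Lemma along_along g w s r : along (along g w s) w r = along g w (s + r).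
Proof. by apply/funext => x; rewrite /along mulrDl addrA. Qed.

Lemma compatible_along C g w s : compatible C g -> compatible C w ->
  compatible C (along g w s).
Proof.
move=> hg hw F CF; exact: affine_onD (hg F CF) (affine_onZ s (hw F CF)).
Qed.

Lemma full_cells_enum C : polyhedral_complex C ->
  exists n, full_cells C #= `I_n.
Proof.
move=> hC; apply/finite_setP; apply: sub_finite_set (complex_finite hC).
by move=> P [].
Qed.

(** On a full cell Q of D the function g is a single affine function, which is
also the one of any cell P i of C that contains an interior point of Q. The
affine functions of g + e w and g - e w on P i lie below these two functions;
as they add up to 2 g on Q, both are attained there, so w is affine on Q. *)
Lemma perturbable_compatible C D g w : polyhedral_complex C ->
  polyhedral_complex D -> compatible C g -> compatible C w ->
  compatible D g -> perturbable g w -> compatible D w.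
Proof.
move=> hC hD Cg Cw Dg [e e0 he] F DF.
have [n hn] := full_cells_enum hC.
have [P [y [hP _ PC _]]] := enum_full_cells hC hn.
have [a ha] := compatible_extends (fun i => (PC i).1) Cg.
have [b hb] := compatible_extends (fun i => (PC i).1) Cw.
have [Q [DQ dQ] FQ] := sub_full_cell hD DF.
have [al [hal alE]] := affine_onE (Dg _ DQ).
have [z hz] := full_core (complex_polyhedron hD DQ) dQ.
have [i Pz] := cell_covers hP z.
have hg := perturbable_convex (ex_intro2 _ _ e e0 he).
have alEi : a i = al.
  apply: (affine_touch (extends_affine ha i) hal hz) => [x Qx|].
    by rewrite -alE// (extends_support hP).
  by rewrite -(extendsE ha Pz) alE//; exact: core_mem.
have [phi [c bE]] := extends_affine hb i; exists phi, c => x /FQ Qx.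
rewrite -bE//; have gE : g x = a i x by rewrite alEi alE.
have hab s := extendsD s ha hb.
have ne : `|e| <= e by rewrite (ger0_norm (ltW e0)).
have nNe : `|- e| <= e by rewrite normrN.
have up : a i x + e * b i x <= g x + e * w x :> R.
  exact (extends_support hP i x (hab e) (he e ne)).
have dn : a i x + - e * b i x <= g x + - e * w x :> R.
  exact (extends_support hP i x (hab (- e)) (he (- e) nNe)).
move: up dn; rewrite gE !lerD2l !mulNr lerN2 !ler_pM2l// => up dn.
by apply/le_anti; rewrite up dn.
Qed.

(** An optimal complex D for g is compatible with g + s w. If g + s w needs
all the cells of D, then its affine functions on these cells are distinct, and
the hypothesis of [convex_perturb] that w merges the cells that g + s w merges
is void. *)
Lemma perturbable_pieces C g w s : polyhedral_complex C ->
  compatible C g -> compatible C w -> perturbable g w ->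
  convexfct (along g w s) ->
  (npieces (along g w s) <= npieces g)%N /\
  (npieces (along g w s) = npieces g -> perturbable (along g w s) w).
Proof.
move=> hC Cg Cw pgw hs.
have [|[D [hD Dg Dn]] _] := npiecesP (f := g); first by exists C.
have Dw := perturbable_compatible hC hD Cg Cw Dg pgw.
have Ds := compatible_along s Dg Dw.
have [|_ hmin] := npiecesP (f := along g w s); first by exists D.
split; first by apply: hmin; exists D; split.
move=> eqn; have [P [y [hP Pinj PD _]]] := enum_full_cells hD Dn.
have [a ha] := compatible_extends (fun i => (PD i).1) Ds.
have [b hb] := compatible_extends (fun i => (PD i).1) Dw.
have [e e0 he] : exists2 e : R, 0 < e & forall r, `|r| <= e ->
    convexfct (fun x => along g w s x + r * w x : R).
  apply: (convex_perturb hP ha hb hs) => i j aij; congr b.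
  apply/eqP/negPn/negP => ij.
  have := fewer_pieces hP (fun i => (PD i).2) ha hs ij aij.
  by rewrite eqn ltnn.
by exists e.
Qed.

(** The bound on s is never reached: convexity is a closed condition, and by
the previous lemma it is also open along the line as long as no piece is lost.
*)
Lemma convex_along_unbounded C g h w : polyhedral_complex C ->
  compatible C g -> compatible C h -> compatible C w ->
  perturbable g w -> perturbable h w ->
  (forall s, convexfct (along g w s) -> convexfct (along h w s) ->
    (npieces (along g w s) <= npieces g)%N ->
    (npieces (along h w s) <= npieces h)%N ->
    npieces (along g w s) = npieces g /\ npieces (along h w s) = npieces h) ->
  ~ has_ubound [set s | convexfct (along g w s) /\ convexfct (along h w s)].
Proof.
move=> hC Cg Ch Cw pg ph hmin ubT; set T := [set s | _] in ubT.
have cg := perturbable_convex pg.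
have ch := perturbable_convex ph.
have supT : has_sup T by split=> //; exists 0; rewrite /T/= !along0.
pose s := sup T.
(* The convexity gaps of u + r w are affine in r, so they stay nonnegative in
   the limit. *)
have closed u : (forall r, T r -> convexfct (along u w r)) ->
    convexfct (along u w s).
  move=> hu x v t t01; rewrite -subr_le0 leNgt; apply/negP => lt0.
  pose del := convexity_gap x v t.
  have delE r : del (along u w r) = del u + r * del w.
    by rewrite /del/convexity_gap/along; ring.
  have {}lt0 : del u + s * del w < 0.
    by rewrite -delE -oppr_gt0 /del/convexity_gap opprB.
  have [e e0 he] := near0_interval (near0_lt0 (- del w) lt0).
  have [r Tr sr] := sup_adherent e0 supT.
  have : 0 <= del (along u w r) by rewrite subr_ge0; exact: hu.
  rewrite delE leNgt => /negP; apply.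
  have := sup_upper_bound supT Tr; rewrite -/s le_eqVlt => /orP[/eqP->//|rs].
  have := he (s - r).
  rewrite subr_gt0 rs -/s ltrBlDl -ltrBlDr sr => /(_ isT) /=.
  by apply: le_lt_trans; lra.
have gs : convexfct (along g w s) by apply: closed => r [].
have hs : convexfct (along h w s) by apply: closed => r [].
have [gn gp] := perturbable_pieces hC Cg Cw pg gs.
have [hn hp] := perturbable_pieces hC Ch Cw ph hs.
have [/gp[e1 e10 he1] /hp[e2 e20 he2]] := hmin s gs hs gn hn.
pose e := Num.min e1 e2.
have e0 : 0 < e by rewrite lt_min e10.
have : T (s + e).
  by split; rewrite -along_along; [apply: he1|apply: he2];
     rewrite ger0_norm ?(ltW e0)// ge_min lexx ?orbT.
by move/(sup_upper_bound supT); rewrite -/s leNgt ltrDl e0.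
Qed.

Lemma convexfct_unbounded g w :
  ~ has_ubound [set s | convexfct (along g w s)] -> convexfct w.
Proof.
move=> nub x v t t01; rewrite leNgt; apply/negP => lt0; apply: nub.
pose del := convexity_gap x v t.
have dw : del w < 0 by rewrite -oppr_gt0 /del/convexity_gap opprB subr_gt0.
exists (del g / - del w) => r /= /(_ x v t t01); rewrite -subr_ge0 => hr.
rewrite ler_pdivlMr ?oppr_gt0// mulrN -subr_ge0 opprK.
by apply: le_trans hr _; rewrite /del/convexity_gap/along; lra.
Qed.

Lemma convex_concave_affine C w : polyhedral_complex C -> compatible C w ->
  convexfct w -> convexfct (fun x => - w x : R) -> affine_on setT w.
Proof.
move=> hC Cw hw hNw.
have [n hn] := full_cells_enum hC.
have [P [y [hP _ PC _]]] := enum_full_cells hC hn.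
have [b hb] := compatible_extends (fun i => (PC i).1) Cw.
have [i _] := cell_covers hP 0.
have [phi [c bE]] := extends_affine hb i; exists phi, c => x _; rewrite -bE//.
apply/le_anti/andP; split; last exact (extends_support hP i x hb hw).
rewrite -lerN2.
have core_i := cell_core hP i.
apply: (convex_above_tangent (a := fun x => - b i x : R) hNw _ core_i).
  exists (\- phi), (- c) => z _; rewrite bE//=.
  by rewrite opprD.
by move=> z Pz; rewrite (extendsE hb Pz).
Qed.

End Directions.

(** * Classes modulo affine functions and the exposing functional *)
Section Classes.
Context {R : realType} {d : nat} {C : set (set 'rV[R]_d)}.
Local Notation point := 'rV[R]_d.
Implicit Types (g h w : VC C) (u : VCbar C).

Lemma VC_compat g : compatible C g.
Proof. exact/asboolP/(VC_compatible g). Qed.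

Lemma VC_alongE g w (s : R) : VC_fun (g + s *: w) = along g w s.
Proof. by []. Qed.

Lemma VCplusP g : VCplus C (VCbar_class g) <-> convexfct g.
Proof.
split=> [[g' [/convexfctP hg' /eqP]]|hg]; last first.
  by exists g; split=> //; exact/convexfctP.
rewrite VCbar_classE => /asboolP aff.
have -> : VC_fun g = (fun x => 1 * g' x + 1 * (g - g') x : R).
  apply/funext => x; rewrite !mul1r addrC.
  by rewrite -[LHS](subrK (g' x : R)).
by apply: convexfct_comb => //; exact: convexfct_affine.
Qed.

Lemma VCbar_functional (L : VC C -> R) :
  (forall s g h, L (s *: g + h) = s * L g + L h) ->
  (forall g, affine_on setT g -> L g = 0) ->
  exists phi : {linear VCbar C -> R^o}, forall g, phi (VCbar_class g) = L g.
Proof.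
move=> Llin Laff; pose phi u : R^o := L (repr u).
have phiE g : phi (VCbar_class g) = L g.
  have aff : repr (VCbar_class g) - g \in @Aff R d C.
    by rewrite -VCbar_classE VCbar_reprK.
  rewrite /phi -[repr _](subrK g) -[X in X + _]scale1r Llin mul1r.
  by rewrite Laff ?add0r//; exact/asboolP.
have philin : linear phi.
  move=> s u v; have -> : s *: u + v = VCbar_class (s *: repr u + repr v).
    by rewrite VCbar_classD VCbar_classZ !VCbar_reprK.
  by rewrite phiE Llin.
pose Phi : {linear VCbar C -> R^o} :=
  HB.pack phi (GRing.isLinear.Build _ _ _ _ phi philin).
by exists Phi.
Qed.

(** The functional is the sum of the convexity gaps from y i towards y j over
the pairs with a i = a j. The parameter t is so small that y i + t (y j - y i)
is still in P i; the gap is then t times the height of the function above its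
own affine function of P i at y j, so it vanishes exactly when the affine
functions of P i and P j coincide. *)
Lemma tangency_functional (n : nat) (P : 'I_n -> set point) y a g :
  cell_cover P y -> extends P a g -> convexfct g ->
  exists phi : {linear VCbar C -> R^o},
    [/\ forall u, VCplus C u -> (0 <= phi u :> R), phi (VCbar_class g) = 0 &
      forall g' a', extends P a' g' -> convexfct g' ->
        phi (VCbar_class g') = 0 -> forall i j, a i = a j -> a' i = a' j].
Proof.
move=> hP ha hg.
have tP i j : exists t : R, 0 < t <= 1 /\ P i (y i + t *: (y j - y i)).
  near (0:R)^'+ => t; exists t; split; last by near: t; exact: (cell_core hP i).
  by apply/andP; split; [by []|near: t; exact: nbhs_right_le].
have [t ht] := choice (fun ij : 'I_n * 'I_n => tP ij.1 ij.2).
pose gap ij := convexity_gap (y ij.1) (y ij.2 - y ij.1) (t ij).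
have gapE ij a' g' : extends P a' g' ->
    gap ij g' = t ij * (a' ij.2 (y ij.2) - a' ij.1 (y ij.2)).
  move=> ha'; have [_ Pt] := ht ij.
  rewrite /gap /convexity_gap (extendsE ha' Pt).
  rewrite (affineE _ _ _ (extends_affine ha' _)) !subrKC.
  rewrite !(extendsE ha' (core_mem (cell_core hP _))); ring.
pose L g' := \sum_(ij | `[< a ij.1 = a ij.2 >]) gap ij g'.
have [||phi phiE] := @VCbar_functional L.
- move=> s g1 g2; rewrite /L mulr_sumr -big_split/=; apply: eq_bigr => ij _.
  rewrite /gap /convexity_gap.
  have E z : (s *: VC_fun g1 + VC_fun g2) z = s * g1 z + g2 z :> R by [].
  by rewrite !E; ring.
- move=> g' aff; apply: big1 => ij _; rewrite /gap /convexity_gap.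
  by rewrite (affineE _ _ _ aff) subrr.
have gap_ge0 g' ij : convexfct g' -> 0 <= gap ij g'.
  move=> hg'; rewrite subr_ge0; apply: hg'.
  by have [/andP[t0 ->] _] := ht ij; rewrite ltW.
exists phi; split.
- move=> u; rewrite -[u]VCbar_reprK => /VCplusP hu; rewrite phiE.
  by apply: sumr_ge0 => ij _; exact: gap_ge0.
- rewrite phiE; apply: big1 => ij /asboolP aij.
  by rewrite (gapE _ _ _ ha) aij subrr mulr0.
move=> g' a' ha' hg'; rewrite phiE => /eqP.
rewrite psumr_eq0 => [|ij _]; last exact: gap_ge0.
move=> /allP gap0 i j aij.
have := gap0 (i, j); rewrite mem_index_enum => /(_ isT)/implyP.
move=> /(_ (asboolT aij)); rewrite (gapE _ _ _ ha') mulf_eq0/=.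
move=> /orP[/eqP t0|].
  by have [/andP[]] := ht (i, j); rewrite t0 ltxx.
rewrite subr_eq0 => /eqP aE.
have [hai haj] := (extends_affine ha' i, extends_affine ha' j).
apply: (affine_touch hai haj (cell_core hP j)).
  by move=> x Px; rewrite -(extendsE ha' Px) (extends_support hP).
exact/esym.
Unshelve. all: by end_near. Qed.

End Classes.

Lemma leq_pair_ltn (m1 m2 n1 n2 : nat) : (m1 <= n1)%N -> (m2 <= n2)%N ->
  ~ (m1 = n1 /\ m2 = n2) -> (m1 < n1)%N \/ (m2 < n2)%N.
Proof.
rewrite leq_eqVlt => /orP[/eqP e1|]; last by left.
by rewrite leq_eqVlt => /orP[/eqP e2 []|]; [split|right].
Qed.

Theorem theorem4p12 (R : realType) (d : nat) (f : 'rV[R]_d -> R^o)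
    (C : set (set 'rV[R]_d)) (hf : cpwl f) (hC : polyhedral_complex C)
    (gh : VCbar C * VCbar C) (hgh : minimal_decomposition C f gh) :
  vertex (decomposition_polyhedron C f) gh.
Proof.
have [n hn] := full_cells_enum hC.
have [P [y [hP _ PC _]]] := enum_full_cells hC hn.
case: gh hgh => _ _ [[/= [g [/convexfctP hg ->]] [h [/convexfctP hh ->]]]].
move=> [F Ff FE] hmin.
have ext (w : VC C) := compatible_extends (fun i => (PC i).1) (VC_compat w).
have [a ha] := ext g; have [b hb] := ext h.
have [phi [phi_ge0 phi0 phiP]] := tangency_functional hP ha hg.
have [psi [psi_ge0 psi0 psiP]] := tangency_functional hP hb hh.
pose chi (u : VCbar C * VCbar C) : R^o := - (phi u.1 + psi u.2).
have chilin : linear chi.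
  move=> s u v; rewrite /chi /= !linearP/= scalerN -opprD scalerDr.
  by rewrite addrACA.
pose Chi : {linear (VCbar C * VCbar C)%type -> R^o} :=
  HB.pack chi (GRing.isLinear.Build _ _ _ _ chi chilin).
exists Chi, 0.
split=> [u [/phi_ge0 u1 /psi_ge0 u2 _]|/=].
  by rewrite /= oppr_le0 addr_ge0.
apply/seteqP; split=> [_ ->|[u1 u2] [[/= Cu1 Cu2 [F' Ff' FE']]]].
  split; last by rewrite /= /chi /= phi0 psi0 addr0 oppr0.
  by split; [exact/VCplusP|exact/VCplusP|exists F].
rewrite /= /chi /= => /eqP; rewrite oppr_eq0.
rewrite paddr_eq0; [|exact: phi_ge0|exact: psi_ge0].
move=> /andP[/eqP phiu /eqP psiu].
have {F' Ff' FE'} uE : u1 - u2 = VCbar_class g - VCbar_class h.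
  by rewrite -FE -FE'; congr VCbar_class; apply: val_inj; rewrite /= Ff.
pose w := repr u1 - g.
have u1E : u1 = VCbar_class (g + 1 *: w) by rewrite scale1r subrKC VCbar_reprK.
have u2E : u2 = VCbar_class (h + 1 *: w).
  rewrite scale1r VCbar_classD VCbar_classD VCbar_classN VCbar_reprK.
  by rewrite addrCA -[_ - _]opprB -uE opprB subrKC.
suff affw : affine_on setT w.
  rewrite /set1/= u1E u2E; congr pair; apply/eqP; rewrite VCbar_classE.
    by rewrite scale1r addrAC subrr add0r; exact/asboolP.
  by rewrite scale1r addrAC subrr add0r; exact/asboolP.
have [c hc] := ext w.
have pert (k : VC C) (phi' : {linear VCbar C -> R^o}) ak :
    extends P ak k -> convexfct k ->
    (forall (g' : VC C) a', extends P a' g' -> convexfct g' ->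
      phi' (VCbar_class g') = 0 -> forall i j, ak i = ak j -> a' i = a' j) ->
    VCplus C (VCbar_class (k + 1 *: w)) ->
    phi' (VCbar_class (k + 1 *: w)) = 0 ->
    perturbable k w /\ perturbable k (- w : VC C).
  move=> hak hk phiP' /VCplusP hk1 phik1.
  have cij i j : ak i = ak j -> c i = c j.
    move=> aij.
    have e := phiP' (k + 1 *: w) _ (extendsD 1 hak hc) hk1 phik1 i j aij.
    apply/funext => x; have := congr1 (@^~ x) e.
    by rewrite aij !mul1r => /addrI.
  have [e e0 he] := convex_perturb hP hak hc hk cij.
  split; first by exists e.
  exists e => // s hs; have := he (- s); rewrite normrN => /(_ hs).
  by congr convexfct; apply/funext => x; rewrite /along mulNr mulrN.
rewrite u1E in Cu1 phiu; rewrite u2E in Cu2 psiu.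
have [pg pgN] := pert g phi a ha hg phiP Cu1 phiu.
have [ph phN] := pert h psi b hb hh psiP Cu2 psiu.
(* Minimality forbids to lose pieces anywhere on the line through (g, h). *)
have minw (w' : VC C) (s : R) :
    convexfct (along g w' s) -> convexfct (along h w' s) ->
    (npieces (along g w' s) <= npieces g)%N ->
    (npieces (along h w' s) <= npieces h)%N ->
    npieces (along g w' s) = npieces g /\ npieces (along h w' s) = npieces h.
  rewrite -!VC_alongE -!npieces_class => cg ch ng nh.
  have [//|neq] := pselect (class_npieces (VCbar_class (g + s *: w')) =
      class_npieces (VCbar_class g) /\
    class_npieces (VCbar_class (h + s *: w')) = class_npieces (VCbar_class h)).
  case: hmin; exists (VCbar_class (g + s *: w'), VCbar_class (h + s *: w')).
  split=> //=.
  - by move=> [e1 e2]; apply: neq; rewrite e1 e2.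
  - split; [exact/VCplusP|exact/VCplusP|exists F => //=].
    by rewrite FE !VCbar_classD opprD addrACA subrr addr0.
  - exact: leq_pair_ltn ng nh neq.
have nub (w' : VC C) : perturbable g w' -> perturbable h w' -> convexfct w'.
  move=> pg' ph'.
  have nub := convex_along_unbounded hC (VC_compat g) (VC_compat h)
    (VC_compat w') pg' ph' (minw w').
  apply: (@convexfct_unbounded _ _ g) => -[M hM]; apply: nub.
  by exists M => s [/hM].
apply: (convex_concave_affine hC (VC_compat w)); first exact: nub.
exact: (nub (- w)).
Qed.
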